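(* Let $A\in\mathbb{R}^{m\times n}$, $\mathbf{b},\boldsymbol{\varphi}\in\mathbb{R}^m$, $\mathbf{c},\mathbf{d}\in\mathbb{R}^n$, and let $\Lambda\subseteq\mathbb{R}$ be an interval such that for every $\lambda\in\Lambda$ the linear program $f_c(\lambda)=\min\{(\mathbf{c}+\lambda\mathbf{d})^t\mathbf{x}: A\mathbf{x}\le\mathbf{b},\ \mathbf{x}\ge0\}$ is feasible with finite optimal value. Write $f_c(\lambda)=\min\{\alpha_j\lambda+\beta_j : j=1,\dots,p\}$ for $\lambda\in\Lambda$, and let $I_j\subseteq\Lambda$ be an interval on which $f_c(\lambda)=\alpha_j\lambda+\beta_j$. Let $$h_c(\lambda)=\min\{\boldsymbol{\varphi}^t\mathbf{y}: \mathbf{b}^t\mathbf{y}\ge f_c(\lambda),\ A^t\mathbf{y}\le\mathbf{c}+\lambda\mathbf{d},\ \mathbf{y}\le0\}\quad(\lambda\in\Lambda),$$ assumed finite for every $\lambda\in\Lambda$, and $$h_c^{(j)}(\lambda)=\min\{\boldsymbol{\varphi}^t\mathbf{y}: \mathbf{b}^t\mathbf{y}\ge\alpha_j\lambda+\beta_j,\ A^t\mathbf{y}\le\mathbf{c}+\lambda\mathbf{d},\ \mathbf{y}\le0\}\quad(\lambda\in I_j).$$ Then $h_c(\lambda)=h_c^{(j)}(\lambda)$ for all $\lambda\in I_j$, and $h_c^{(j)}$ is a continuous, convex, piecewise linear function on $I_j$.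
   Context: Vector inequalities are componentwise. It is a classical fact that $f_c$ is continuous, concave and piecewise linear on $\Lambda$, so that it is the minimum of finitely many affine functions and $\Lambda$ is a finite union of intervals on each of which one affine piece is active. ''Piecewise linear'' means piecewise affine with finitely many pieces. *)

(* Defs.v *)
From mathcomp Require Import all_boot all_order all_algebra.
From mathcomp Require Import all_classical all_reals all_analysis.

Set Implicit Arguments.
Unset Strict Implicit.
Unset Printing Implicit Defensive.

Import Order.TTheory GRing.Theory Num.Theory.
Import numFieldNormedType.Exports.

Local Open Scope classical_set_scope.
Local Open Scope ring_scope.

Definition dot (R : realType) (k : nat) (u v : 'cV[R]_k) : R :=
  (u^T *m v) 0 0.

Definition levec (R : realType) (k : nat) (u v : 'cV[R]_k) : Prop :=
  forall i, u i 0 <= v i 0.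

(* Optimal value of min {g^t x : x in D}, with the usual conventions: +oo when
   D is empty and -oo when the objective is unbounded below. Being a fin_num
   therefore means "feasible with finite optimal value". *)
Definition lp_min (R : realType) (k : nat) (g : 'cV[R]_k) (D : set 'cV[R]_k) :
    \bar R :=
  ereal_inf [set (dot g x)%:E | x in D].

Definition f_feasible (R : realType) (m n : nat) (A : 'M[R]_(m, n))
    (b : 'cV[R]_m) : set 'cV[R]_n :=
  [set x | levec (A *m x) b /\ levec 0 x].

Definition f_c (R : realType) (m n : nat) (A : 'M[R]_(m, n)) (b : 'cV[R]_m)
    (c d : 'cV[R]_n) (l : R) : \bar R :=
  lp_min (c + l *: d) (f_feasible A b).

(* The threshold t bounds b^t y from below: it is f_c(l) for h_c and
   alpha_j l + beta_j for h_c^(j). *)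
Definition h_feasible (R : realType) (m n : nat) (A : 'M[R]_(m, n))
    (b : 'cV[R]_m) (c d : 'cV[R]_n) (t : \bar R) (l : R) : set 'cV[R]_m :=
  [set y | [/\ (t <= (dot b y)%:E)%E, levec (A^T *m y) (c + l *: d) &
               levec y 0]].

Definition h_c (R : realType) (m n : nat) (A : 'M[R]_(m, n))
    (b phi : 'cV[R]_m) (c d : 'cV[R]_n) (l : R) : \bar R :=
  lp_min phi (h_feasible A b c d (f_c A b c d l) l).

Definition h_cj (R : realType) (m n : nat) (A : 'M[R]_(m, n))
    (b phi : 'cV[R]_m) (c d : 'cV[R]_n) (alpha beta : R) (l : R) : \bar R :=
  lp_min phi (h_feasible A b c d (alpha * l + beta)%:E l).

(* Piecewise affine with finitely many pieces, each piece living on an interval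
   (possibly degenerate). *)
Definition piecewise_linear (R : realType) (I : set R) (f : R -> R) : Prop :=
  exists (k : nat) (J : 'I_k -> set R) (a e : 'I_k -> R),
    [/\ forall i, is_interval (J i),
        I = \bigcup_(i in [set: 'I_k]) J i &
        forall i x, J i x -> f x = a i * x + e i].

(* Main.v *)
Require Import Defs.
From mathcomp Require Import all_boot all_order all_algebra.
From mathcomp Require Import all_classical all_reals all_analysis.
From mathcomp Require Import lra.

Import Order.TTheory GRing.Theory Num.Theory.
Import numFieldNormedType.Exports.

Local Open Scope classical_set_scope.
Local Open Scope ring_scope.

(** On [I] the threshold [f_c] in the program of [h_c] is
    [alpha j * l + beta j], so [h_c] and [hj] have the same feasible sets
    there, and [hj] inherits finiteness. What remains is a fact on every
    linear program whose right-hand sides depend linearly on a parameter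
    vector [x]: one finite list of linear functions, independent of [x], has
    the optimal value as its maximum wherever this value is finite, and the
    value is attained ([lp_min_max]).

    The reason is that the epigraph of the value function is the projection,
    along the decision variables [y], of the polyhedral cone of all [(x, z, y)]
    with [y] feasible for [x] and [dot g y <= z]. Fourier-Motzkin elimination
    ([fourier_motzkin]) shows that this projection is again cut out by finitely
    many linear inequalities in [(x, z)]. Those that involve [z] with a
    positive coefficient are lower bounds on [z], linear in [x], and
    the optimal value is the largest of them.

    With the parameter vector [(1, l)], where the coordinate 1 carries the
    constant terms, [hj] is on [I] a maximum of finitely many affine functions
    of [l]. Such a maximum is Lipschitz, hence continuous; it is convex; and it
    is piecewise linear, because on an interval the set where a convex function
    meets an affine minorant is an interval. *)

(** * The scalar product *)

Lemma dotE {R : realType} {k : nat} (u v : 'cV[R]_k) :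
  dot u v = \sum_i u i 0 * v i 0.
Proof. by rewrite /dot mxE; apply: eq_bigr => i _; rewrite mxE. Qed.

Lemma dotDl {R : realType} {k : nat} (u v x : 'cV[R]_k) :
  dot (u + v) x = dot u x + dot v x.
Proof. by rewrite /dot linearD /= mulmxDl mxE. Qed.

Lemma dotZl {R : realType} {k : nat} (a : R) (u x : 'cV[R]_k) :
  dot (a *: u) x = a * dot u x.
Proof. by rewrite /dot linearZ /= -scalemxAl mxE. Qed.

Lemma dotNl {R : realType} {k : nat} (u x : 'cV[R]_k) : dot (- u) x = - dot u x.
Proof. by rewrite -scaleN1r dotZl mulN1r. Qed.

Lemma dot0l {R : realType} {k : nat} (x : 'cV[R]_k) : dot 0 x = 0.
Proof. by rewrite -(scale0r 0) dotZl mul0r. Qed.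

Lemma dot_col_mx {R : realType} {k q : nat} (u x : 'cV[R]_k) (v y : 'cV[R]_q) :
  dot (col_mx u v) (col_mx x y) = dot u x + dot v y.
Proof. by rewrite /dot tr_col_mx mul_row_col mxE. Qed.

Lemma dot_cV1 {R : realType} (u x : 'cV[R]_1) : dot u x = u 0 0 * x 0 0.
Proof. by rewrite dotE big_ord1. Qed.

(** * Elimination of variables *)

Definition sols {R : realType} {k q : nat} (S : seq ('cV[R]_k * 'cV[R]_q))
    (x : 'cV[R]_q) : set 'cV[R]_k :=
  [set y | forall s, s \in S -> dot s.1 y <= dot s.2 x].

(** Separating finite sets of lower and upper bounds is what makes the
    elimination of one variable an equivalence. *)
Lemma between_seq {R : realType} (L U : seq R) :
  (forall l u, l \in L -> u \in U -> l <= u) ->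
  exists t, (forall l, l \in L -> l <= t) /\ (forall u, u \in U -> t <= u).
Proof.
elim: L => [_|a L IH LU].
  elim: U => [|u U [t [_ tU]]]; first by exists 0.
  exists (Num.min u t); split=> // v; rewrite inE => /predU1P[->|/tU tv].
    by rewrite ge_min lexx.
  by rewrite ge_min tv orbT.
have [|t [Lt tU]] := IH; first by move=> l u lL; apply: LU; rewrite inE lL orbT.
exists (Num.max a t); split=> [l|u uU].
  by rewrite inE => /predU1P[->|/Lt lt]; rewrite le_max ?lexx ?lt ?orbT.
by rewrite ge_max tU // andbT LU ?mem_head.
Qed.

Lemma exists_max_seq {R : realType} {T : eqType} (g : T -> R) (W : seq T) :
  W != [::] ->
  exists2 w, w \in W & forall v, v \in W -> g v <= g w.
Proof.
elim: W => // a [_ _|b W IH _].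
  by exists a; rewrite ?mem_head // => v; rewrite inE => /eqP ->.
have [//|w wW wmax] := IH.
have [wa|aw] := leP (g w) (g a).
  exists a; first by rewrite mem_head.
  move=> v; rewrite inE => /predU1P[->//|/wmax vw].
  exact: le_trans vw wa.
exists w; first by rewrite inE wW orbT.
by move=> v; rewrite inE => /predU1P[->|/wmax//]; exact: ltW.
Qed.

Definition head_coef {R : realType} {k q : nat}
    (s : 'cV[R]_(1 + k) * 'cV[R]_q) : R := usubmx s.1 0 0.

(** One step of Fourier-Motzkin. A constraint with positive head coefficient is
    an upper bound on the first variable, one with negative head coefficient a
    lower bound; each pair of such constraints is normalised and added, so
    that the first variable cancels. *)
Definition eliminate {R : realType} {k q : nat}
    (S : seq ('cV[R]_(1 + k) * 'cV[R]_q)) : seq ('cV[R]_k * 'cV[R]_q) :=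
  [seq (dsubmx s.1, s.2) | s <- S & head_coef s == 0] ++
  [seq ((head_coef s)^-1 *: dsubmx s.1 - (head_coef r)^-1 *: dsubmx r.1,
        (head_coef s)^-1 *: s.2 - (head_coef r)^-1 *: r.2)
     | s <- [seq s <- S | 0 < head_coef s], r <- [seq r <- S | head_coef r < 0]].

Lemma dot_head {R : realType} {k q : nat} (s : 'cV[R]_(1 + k) * 'cV[R]_q)
    (t : R) (y : 'cV[R]_k) :
  dot s.1 (col_mx t%:M y) = head_coef s * t + dot (dsubmx s.1) y.
Proof.
by rewrite -{1}(vsubmxK s.1) dot_col_mx dot_cV1 [t%:M _ _]mxE eqxx mulr1n.
Qed.

Lemma eliminateP {R : realType} {k q : nat}
    (S : seq ('cV[R]_(1 + k) * 'cV[R]_q)) (x : 'cV[R]_q) (y : 'cV[R]_k) :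
  sols (eliminate S) x y <-> exists t : R, sols S x (col_mx t%:M y).
Proof.
(* The bound that the constraint s puts on the first variable. *)
pose bnd (s : 'cV[R]_(1 + k) * 'cV[R]_q) :=
  (head_coef s)^-1 * (dot s.2 x - dot (dsubmx s.1) y).
have bndP s t : 0 < head_coef s ->
    (dot s.1 (col_mx t%:M y) <= dot s.2 x) = (t <= bnd s).
  by move=> s0; rewrite dot_head -lerBrDr ler_pdivlMl.
have bndN s t : head_coef s < 0 ->
    (dot s.1 (col_mx t%:M y) <= dot s.2 x) = (bnd s <= t).
  by move=> s0; rewrite dot_head -lerBrDr ler_ndivrMl.
split=> [ely|[t St] s]; last first.
  rewrite mem_cat => /orP[/mapP[r]|/allpairsP[[r r'] /= []]].
    rewrite mem_filter => /andP[/eqP r0 rS] ->.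
    by have := St r rS; rewrite dot_head r0 mul0r add0r.
  rewrite !mem_filter => /andP[r0 rS] /andP[r'0 r'S] -> /=.
  have := St r rS; rewrite bndP // => tr.
  have := St r' r'S; rewrite bndN // => /le_trans/(_ tr).
  rewrite /bnd !dotDl !dotNl !dotZl; lra.
have [|t [Lt tU]] := between_seq [seq bnd s | s <- S & head_coef s < 0]
                                 [seq bnd s | s <- S & 0 < head_coef s].
  move=> _ _ /mapP[r rN ->] /mapP[s sP ->].
  have /ely : ((head_coef s)^-1 *: dsubmx s.1 - (head_coef r)^-1 *: dsubmx r.1,
        (head_coef s)^-1 *: s.2 - (head_coef r)^-1 *: r.2) \in eliminate S.
    rewrite mem_cat; apply/orP; right.
    by apply/allpairsP; exists (s, r).
  rewrite /bnd /= !dotDl !dotNl !dotZl; lra.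
exists t => s sS; have [s0|s0|s0] := ltgtP (head_coef s) 0.
- by rewrite bndN // Lt //; apply/map_f; rewrite mem_filter s0.
- by rewrite bndP // tU //; apply/map_f; rewrite mem_filter s0.
- rewrite dot_head s0 mul0r add0r.
  apply: (ely (dsubmx s.1, s.2)); rewrite mem_cat; apply/orP; left.
  by apply/mapP; exists s => //; rewrite mem_filter s0 eqxx.
Qed.

(** The projection of a polyhedral cone is a polyhedral cone. The parameters
    [x] are the coordinates kept; the list [T] does not depend on them. *)
Lemma fourier_motzkin {R : realType} {k q : nat}
    (S : seq ('cV[R]_k * 'cV[R]_q)) :
  exists T : seq 'cV[R]_q, forall x,
    (exists y, sols S x y) <-> (forall v, v \in T -> 0 <= dot v x).
Proof.
elim: k S => [|k IH] S.
  exists [seq s.2 | s <- S] => x; split=> [[y Sy] _ /mapP[s sS ->]|Tx].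
    by have := Sy s sS; rewrite dotE big_ord0.
  by exists 0 => s sS; rewrite dotE big_ord0 Tx //; apply: map_f.
have [T TP] := IH (eliminate (S : seq ('cV[R]_(1 + k) * _))).
exists T => x; rewrite -TP; split=> [[y Sy]|[y /eliminateP[t St]]]; last first.
  by exists (col_mx t%:M y).
exists (dsubmx (y : 'cV_(1 + k))); apply/eliminateP.
exists (usubmx (y : 'cV_(1 + k)) 0 0).
by rewrite -mx11_scalar vsubmxK.
Qed.

(** * The value of a parametric linear program *)

(** The value is the minimum of the [z] for which [(x, z)] lies in the projected
    cone. An inequality of the cone with nonpositive coefficient on [z] that
    holds at one [z] holds at every smaller one, so below the objective value
    of a feasible point only the lower bounds [W] matter. [W] is nonempty,
    since otherwise the program would be unbounded, and the largest of its
    bounds is attained. *)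
Lemma lp_min_max {R : realType} {k q : nat} (g : 'cV[R]_k)
    (S : seq ('cV[R]_k * 'cV[R]_q)) :
  exists W : seq 'cV[R]_q, forall x, lp_min g (sols S x) \is a fin_num ->
    [/\ exists2 w, w \in W & lp_min g (sols S x) = (dot w x)%:E,
        forall w, w \in W -> ((dot w x)%:E <= lp_min g (sols S x))%E &
        exists2 y, sols S x y & lp_min g (sols S x) = (dot g y)%:E].
Proof.
(* The constraints of the epigraph: dot g y <= z is the first one. *)
pose S' : seq ('cV[R]_k * 'cV[R]_(q + 1)) :=
  (g, col_mx 0 1%:M) :: [seq (s.1, col_mx s.2 0) | s <- S].
have S'P x z y : sols S' (col_mx x z%:M) y <-> sols S x y /\ dot g y <= z.
  split=> [S'y|[Sy gz] s].
    split=> [s sS|].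
      have := S'y (s.1, col_mx s.2 0); rewrite /= dot_col_mx dot0l addr0.
      by apply; rewrite inE; apply/orP; right; apply/mapP; exists s.
    have := S'y _ (mem_head _ _).
    by rewrite /= dot_col_mx dot0l add0r dot_cV1 !mxE eqxx mul1r mulr1n.
  rewrite inE => /predU1P[->|/mapP[r rS ->]] /=.
    by rewrite dot_col_mx dot0l add0r dot_cV1 !mxE eqxx mul1r mulr1n.
  by rewrite dot_col_mx dot0l addr0; apply: Sy.
have [T TP] := fourier_motzkin S'.
(* The coefficient of z in v, and the lower bound on z obtained from v. *)
pose h (v : 'cV[R]_(q + 1)) := dsubmx v 0 0.
have dotT v x z : dot v (col_mx x z%:M) = dot (usubmx v) x + h v * z.
  by rewrite -{1}(vsubmxK v) dot_col_mx dot_cV1 [_%:M _ _]mxE eqxx mulr1n.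
pose w_of v := - (h v)^-1 *: usubmx v.
pose W := [seq w_of v | v <- T & 0 < h v].
exists W => x xfin.
have w_le v z : 0 < h v -> (dot (w_of v) x <= z) = (0 <= dot v (col_mx x z%:M)).
  move=> v0; rewrite dotT /w_of dotZl mulNr lerNl.
  by rewrite ler_pdivlMl// mulrN -subr_ge0 opprK.
have lb w y : w \in W -> sols S x y -> dot w x <= dot g y.
  case/mapP=> v; rewrite mem_filter => /andP[v0 vT] -> Sy.
  by rewrite w_le //; apply: (TP _).1 vT; exists y; apply/S'P.
have lbE w : w \in W -> ((dot w x)%:E <= lp_min g (sols S x))%E.
  by move=> wW; apply/ereal_infP => _ [y Sy <-]; rewrite lee_fin lb.
have [y0 Sy0] : exists y, sols S x y.
  apply: contrapT => noy; move: xfin; rewrite /lp_min.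
  suff -> : [set (dot g y)%:E | y in sols S x] = set0 by rewrite ereal_inf0.
  by rewrite -subset0 => t [y Sy _]; apply: noy; exists y.
have below z : z <= dot g y0 -> (forall w, w \in W -> dot w x <= z) ->
    exists2 y, sols S x y & dot g y <= z.
  move=> zy0 Wz; have [y] : exists y, sols S' (col_mx x z%:M) y.
    apply/(TP _) => v vT; have [v0|v0] := leP (h v) 0; last first.
      by rewrite -w_le // Wz //; apply: map_f; rewrite mem_filter v0.
    have /(TP _)/(_ v vT) : exists y, sols S' (col_mx x (dot g y0)%:M) y.
      by exists y0; apply/S'P.
    move/le_trans; apply; rewrite !dotT lerD2l.
    exact: ler_wnM2l.
  by case/S'P=> Sy gz; exists y.
have inf_le y : sols S x y -> (lp_min g (sols S x) <= (dot g y)%:E)%E.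
  by move=> Sy; apply: ereal_inf_lbound; exists y.
have W0 : W != [::].
  apply/eqP => W0.
  pose z := Num.min (dot g y0) (fine (lp_min g (sols S x)) - 1).
  have [||y Sy gz] := below z; rewrite ?W0 ?ge_min ?lexx //.
  have := inf_le y Sy; rewrite -(fineK xfin) lee_fin.
  have : z <= fine (lp_min g (sols S x)) - 1 by rewrite ge_min lexx orbT.
  lra.
have [w wW wmax] := exists_max_seq (fun w => dot w x) _ W0.
have [||y Sy gy] := below (dot w x); rewrite ?lb //.
have gyE : dot g y = dot w x by apply/eqP; rewrite eq_le gy lb.
have valE : lp_min g (sols S x) = (dot w x)%:E.
  by apply/eqP; rewrite eq_le lbE // -gyE inf_le.
by split; [exists w | | exists y; rewrite ?gyE].
Qed.

(** * Maxima of finitely many affine functions *)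

(** [f] is on [I] the pointwise maximum of the affine functions with slope
    [w.1] and intercept [w.2], for [w] in [W]. *)
Definition max_affine {R : realType} (I : set R) (W : seq (R * R))
    (f : R -> R) : Prop :=
  forall l, I l -> (exists2 w, w \in W & f l = w.1 * l + w.2) /\
                   (forall w, w \in W -> w.1 * l + w.2 <= f l).

(** At a convex combination, [f] equals one of the affine functions, and that
    function is below [f] at both endpoints. *)
Lemma max_affine_convex {R : realType} (I : set R) W (f : R -> R) :
  is_interval I -> max_affine I W f -> convex_function (E := R^o) I f.
Proof.
move=> I_itv fW.
have cvx (s x y : R) : 0 <= s -> s <= 1 -> I x -> I y ->
    f (s * x + (1 - s) * y) <= s * f x + (1 - s) * f y.
  move=> s0 s1 Ix Iy.
  have Iz : I (s * x + (1 - s) * y).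
    have [xy|yx] := leP x y.
      by apply: (I_itv x y) => //; apply/andP; split; nra.
    by apply: (I_itv y x) => //; apply/andP; split; nra.
  have [[w wW ->] _] := fW _ Iz.
  have := (fW _ Ix).2 w wW; have := (fW _ Iy).2 w wW; nra.
move=> t x y; rewrite !inE => Ix Iy; rewrite !convRE /unstable.onem.
exact: cvx.
Qed.

(** [f] is Lipschitz: if the affine function [w] is active at [x], then
    [f x - f y] is at most the increment of [w] from [y] to [x]. *)
Lemma max_affine_continuous {R : realType} (I : set R) W (f : R -> R) :
  max_affine I W f -> {within I, continuous f}.
Proof.
(* Adding 1 to the sum of the slopes makes K positive even if all vanish. *)
move=> fW; pose K := 1 + \sum_(w <- W) `|w.1|.
have K0 : 0 < K by rewrite ltr_wpDr // sumr_ge0.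
have WK w : w \in W -> `|w.1| <= K.
  move=> wW; rewrite /K (big_rem w) //= addrCA lerDl addr_ge0 // sumr_ge0 //.
have lip x y : I x -> I y -> f x - f y <= K * `|x - y|.
  move=> Ix Iy; have [[w wW ->] _] := fW _ Ix.
  have fy := (fW _ Iy).2 w wW.
  apply: (@le_trans _ _ (w.1 * (x - y))); first by lra.
  rewrite (le_trans (ler_norm _)) // normrM ler_wpM2r // WK //.
apply/subspace_continuousP => x Ix; apply/cvgrPdist_le => e e0.
rewrite near_withinE; near=> y => Iy.
apply: (@le_trans _ _ (K * `|x - y|)).
  by rewrite ler_norml lerNl opprB lip // distrC lip.
rewrite -ler_pdivlMl //; near: y.
by apply: cvgr_dist_le => //; rewrite mulr_gt0 // invr_gt0.
Unshelve. all: by end_near. Qed.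

(** The pieces are the sets where a given affine function is active. Each is an
    interval: an affine function dominated by [w] at both endpoints is
    dominated by [w] in between. *)
Lemma max_affine_piecewise_linear {R : realType} (I : set R) W (f : R -> R) :
  is_interval I -> max_affine I W f -> piecewise_linear I f.
Proof.
move=> I_itv fW; pose w (i : 'I_(size W)) := nth (0, 0) W i.
exists (size W), (fun i => [set l | I l /\ f l = (w i).1 * l + (w i).2]).
exists (fun i => (w i).1), (fun i => (w i).2).
have wW i : w i \in W by apply: mem_nth.
split=> [i x y [Ix fx] [Iy fy] z xzy||i x []//].
- have Iz := I_itv x y Ix Iy z xzy; split=> //.
  apply/eqP; rewrite eq_le (fW _ Iz).2 // andbT.
  have [[v vW ->] _] := fW _ Iz.
  have := (fW _ Ix).2 v vW; have := (fW _ Iy).2 v vW.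
  rewrite fx fy => vy vx; move/andP: xzy => [xz zy].
  have [vi|iv] := leP v.1 (w i).1; nra.
- apply/seteqP; split=> [x Ix|x [i _ []//]].
  have [[v vW fx] _] := fW _ Ix.
  move: (vW); rewrite -index_mem => iW.
  by exists (Ordinal iW) => //; split=> //; rewrite /w /= nth_index.
Qed.

(** * The program in one parameter *)

(** Serves both as the affine function of slope [a] and intercept [e], and,
    as [aff l 1], as the point at which such functions are evaluated. *)
Definition aff {R : realType} (a e : R) : 'cV[R]_2 := \col_i [:: e; a]`_i.

Lemma dot_aff {R : realType} (v : 'cV[R]_2) (l : R) :
  dot v (aff l 1) = v 1 0 * l + v 0 0.
Proof.
rewrite dotE big_ord_recl big_ord1 !mxE /= mulr1 addrC.
by congr (v _ _ * _ + _); apply: val_inj.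
Qed.

Definition h_system {R : realType} {m n : nat} (A : 'M[R]_(m, n))
    (b : 'cV[R]_m) (c d : 'cV[R]_n) (alpha beta : R) :
    seq ('cV[R]_m * 'cV[R]_2) :=
  (- b, aff (- alpha) (- beta)) ::
  [seq (col i A, aff (d i 0) (c i 0)) | i : 'I_n] ++
  [seq (delta_mx i 0, 0) | i : 'I_m].

Lemma h_feasibleE {R : realType} {m n : nat} (A : 'M[R]_(m, n))
    (b : 'cV[R]_m) (c d : 'cV[R]_n) (alpha beta l : R) :
  h_feasible A b c d (alpha * l + beta)%:E l =
  sols (h_system A b c d alpha beta) (aff l 1).
Proof.
have colE i y : dot (col i A) y = (A^T *m y) i 0.
  by rewrite /dot tr_col -row_mul mxE.
have deltaE i y : dot (delta_mx i 0) y = y i 0 :> R.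
  by rewrite /dot trmx_delta -rowE mxE.
apply/seteqP; split=> y; last first.
  move=> Sy; split=> [|i|i].
  - have := Sy _ (mem_head _ _).
    by rewrite /= dot_aff !mxE /= dotNl lee_fin; lra.
  - have /= := Sy (col i A, aff (d i 0) (c i 0)).
    rewrite colE dot_aff !mxE /= => H.
    suff : (A^T *m y) i 0 <= d i 0 * l + c i 0 by rewrite !mxE; lra.
    rewrite !mxE; apply: H; rewrite inE mem_cat.
    apply/orP; right; apply/orP; left.
    by apply/fintype.imageP; exists i.
  - have /= := Sy (delta_mx i 0, 0).
    rewrite deltaE dot0l mxE; apply.
    rewrite inE mem_cat; apply/orP; right; apply/orP; right.
    by apply/fintype.imageP; exists i.
case=> by_ Ay y0 s; rewrite lee_fin in by_.
rewrite inE mem_cat => /predU1P[->|/orP[]/fintype.imageP[i _ ->]] /=.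
- by rewrite dot_aff !mxE /= dotNl; lra.
- by have := Ay i; rewrite colE dot_aff !mxE /=; lra.
- by rewrite deltaE dot0l; have := y0 i; rewrite mxE.
Qed.

Theorem mainTheorem5 (R : realType) (m n : nat) (A : 'M[R]_(m, n))
    (b phi : 'cV[R]_m) (c d : 'cV[R]_n) (Lambda : set R)
    (Lambda_itv : is_interval Lambda)
    (f_fin : forall l, Lambda l -> f_c A b c d l \is a fin_num)
    (p : nat) (alpha beta : 'I_p -> R)
    (f_min : forall l, Lambda l ->
       f_c A b c d l =
       \big[Order.min/+oo%E]_(i < p) (alpha i * l + beta i)%:E)
    (j : 'I_p) (I : set R) (I_itv : is_interval I) (I_sub : I `<=` Lambda)
    (f_active : forall l, I l -> f_c A b c d l = (alpha j * l + beta j)%:E)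
    (h_fin : forall l, Lambda l -> h_c A b phi c d l \is a fin_num) :
  let hj := h_cj A b phi c d (alpha j) (beta j) in
  [/\ forall l, I l -> h_c A b phi c d l = hj l,
      (* the infimum defining hj is a minimum, so hj is finite on I *)
      forall l, I l ->
        exists2 y, h_feasible A b c d (alpha j * l + beta j)%:E l y &
                   hj l = (dot phi y)%:E,
      {within I, continuous (fun l => fine (hj l))},
      convex_function (E := R^o) I (fun l => fine (hj l)) &
      piecewise_linear I (fun l => fine (hj l))].
Proof.
move=> hj.
have hcj l : I l -> h_c A b phi c d l = hj l.
  by move=> Il; rewrite /h_c f_active.
pose S := h_system A b c d (alpha j) (beta j).
have hjE l : hj l = lp_min phi (sols S (aff l 1)).
  by rewrite /hj /h_cj h_feasibleE.
have [W WP] := lp_min_max phi S.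
have S_fin l : I l -> lp_min phi (sols S (aff l 1)) \is a fin_num.
  by move=> Il; rewrite -hjE -hcj // h_fin //; apply: I_sub.
have hjmax : max_affine I [seq (w 1 0, w 0 0) | w : 'cV[R]_2 <- W]
    (fun l => fine (hj l)).
  move=> l Il; have [[w wW hw] Wle _] := WP _ (S_fin l Il).
  rewrite hjE hw /= dot_aff.
  split=> [|_ /mapP[v vW ->]] /=.
    by exists (w 1 0, w 0 0) => //; apply/mapP; exists w.
  by have := Wle v vW; rewrite hw lee_fin !dot_aff.
split=> //.
- move=> l Il; have [_ _ [y Sy hy]] := WP _ (S_fin l Il).
  by exists y; rewrite ?h_feasibleE ?hjE.
- exact: max_affine_continuous hjmax.
- exact: max_affine_convex hjmax.
- exact: max_affine_piecewise_linear hjmax.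
Qed.
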